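(* Let $p\in[1/2,1)$, $q=1-p$ and $\mu=p-q$. For integers $n\ge1$ let $W_{n,p}$ be the number of rounds won by the losing player and $Z_{n,p}$ the net profit of Player 1 in the first-to-reach-$n$ game with constant round-winning probability $p$. Then: (a) For all integers $n\ge 1$ and $0\le k<n$, $$\mathbb{P}(W_{n,p}=k)=\binom{n+k-1}{n-1}q^kp^n+\alpha_{n,p,k},\qquad\text{where } |\alpha_{n,p,k}|\le(4pq)^n.$$ (b) As $n\to\infty$ (with $p$ fixed), $$\frac{pZ_{n,p}-\mu n}{\sqrt{nq}}\to\mathcal{N}(0,1)\quad\text{in distribution.}$$
   Context: First-to-reach-$n$ game, constant model: two players play a sequence of independent rounds; in each round Player 1 wins with probability $p$ and Player 2 wins with probability $q=1-p$. The game stops the first time one of the players has won exactly $n$ rounds (so it lasts at most $2n-1$ rounds); that player is the overall winner. Let $W_{n,p}\in\{0,1,\dots,n-1\}$ be the number of rounds won by the losing player when the game stops. The overall winner receives $n-W_{n,p}$ from the loser, so the net profit of Player 1 is $Z_{n,p}=(n-W_{n,p})\mathbf{1}_{\{\text{Player 1 won}\}}+(W_{n,p}-n)\mathbf{1}_{\{\text{Player 2 won}\}}$. $\mathcal{N}(0,1)$ is the standard normal distribution. *)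

(* Defs.v *)
From HB Require Import structures.
From mathcomp Require Import all_boot all_order all_algebra finmap.
From mathcomp Require Import all_classical all_reals all_analysis.
From mathcomp Require Import measurable_realfun.
Import Order.TTheory GRing.Theory Num.Theory.
Import numFieldNormedType.Exports.

Set Implicit Arguments.
Unset Strict Implicit.
Unset Printing Implicit Defensive.

Local Open Scope classical_set_scope.
Local Open Scope ring_scope.

(* A play is the infinite sequence of the outcomes of the rounds, numbered
   from 0; [r i = true] means that Player 1 wins round [i], and [r i = false]
   that Player 2 does.  Accordingly [true] and [false] name the two players. *)
Section Play.
Local Open Scope nat_scope.
Implicit Types (b : bool) (r : nat -> bool) (m n : nat).

Definition wins b r m := \sum_(i < m) (r i == b).

Definition game_over n r m := (wins true r m == n) || (wins false r m == n).

Lemma winsS b r m : wins b r m.+1 = wins b r m + (r m == b).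
Proof. by rewrite /wins big_ord_recr. Qed.

Lemma wins_sum r m : wins true r m + wins false r m = m.
Proof.
elim: m => [|m IH]; first by rewrite /wins !big_ord0.
by rewrite !winsS addnACA IH; case: (r m); rewrite addn1.
Qed.

Lemma game_over_bound n r : exists2 m, m <= n.*2 & game_over n r m.
Proof.
have H m : (exists2 m', m' <= m & game_over n r m') \/
    (wins true r m < n /\ wins false r m < n).
  elim: m => [|m [[m' le_m go]|[lt1 lt2]]].
  - have [->|n0] := eqVneq n 0; last by right; rewrite /wins !big_ord0 lt0n.
    by left; exists 0 => //; rewrite /game_over /wins !big_ord0.
  - by left; exists m' => //; exact: leqW.
  case E : (game_over n r m.+1); first by left; exists m.+1.
  right; move/negbT: E; rewrite /game_over negb_or => /andP[n1 n2].
  rewrite !ltn_neqAle n1 n2 !winsS.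
  by split; case: (r m); rewrite /= ?addn0 ?addn1 // ltnW.
have [//|[lt1 lt2]] := H n.*2.
have := leq_add lt1 (ltnW lt2).
by rewrite addSn wins_sum addnn ltnn.
Qed.

Lemma game_over_ex n r : exists m, game_over n r m.
Proof. by have [m _ go] := game_over_bound n r; exists m. Qed.

Definition duration n r := ex_minn (game_over_ex n r).

Definition won n b r := wins b r (duration n r) == n.

Definition loser_score n r :=
  wins (if won n true r then false else true) r (duration n r).

End Play.

Definition net_profit (R : realType) (n : nat) (r : nat -> bool) : R :=
  (n%:R - (loser_score n r)%:R) * (won n true r)%:R
  + ((loser_score n r)%:R - n%:R) * (won n false r)%:R.

Section Locality.
Local Open Scope nat_scope.
Variables (n : nat) (r r' : nat -> bool).
Hypothesis rr' : forall i, i < n.*2 -> r i = r' i.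

Lemma wins_local b m : m <= n.*2 -> wins b r m = wins b r' m.
Proof.
by move=> lemn; apply: eq_bigr => i _; rewrite rr' // (leq_trans _ lemn).
Qed.

Lemma duration_local : duration n r = duration n r' /\ duration n r <= n.*2.
Proof.
have [m1 le1 go1] := game_over_bound n r.
have [m2 le2 go2] := game_over_bound n r'.
rewrite /duration; case: ex_minnP => m gm minm; case: ex_minnP => m' gm' minm'.
have lem : m <= n.*2 := leq_trans (minm _ go1) le1.
have lem' : m' <= n.*2 := leq_trans (minm' _ go2) le2.
split=> //; apply/eqP; rewrite eqn_leq; apply/andP; split.
  by apply: minm; rewrite /game_over !wins_local.
by apply: minm'; rewrite /game_over -!wins_local.
Qed.

Lemma won_local b : won n b r = won n b r'.
Proof.
by have [e le] := duration_local; rewrite /won -e (wins_local _ le).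
Qed.

Lemma loser_score_local : loser_score n r = loser_score n r'.
Proof.
have [e le] := duration_local.
by rewrite /loser_score won_local -e (wins_local _ le).
Qed.

Lemma net_profit_local (R : realType) : net_profit R n r = net_profit R n r'.
Proof. by rewrite /net_profit !won_local loser_score_local. Qed.

End Locality.

Lemma measurable_fun_local d d' (T : measurableType d) (T' : measurableType d')
    (X : nat -> {mfun T >-> bool}) (g : (nat -> bool) -> T') (N : nat) :
  (forall r r', (forall i, (i < N)%N -> r i = r' i) -> g r = g r') ->
  measurable_fun [set: T] (fun w => g (X ^~ w)).
Proof.
elim: N g => [|N IH] g gloc.
  rewrite (_ : (fun _ => _) = cst (g xpredT)); first exact: measurable_cst.
  by apply/funext => w; apply: gloc.
pose upd b (r : nat -> bool) i := if i == N then b else r i.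
rewrite (_ : (fun _ => _) = fun w => if X N w then g (upd true (X ^~ w))
                                     else g (upd false (X ^~ w))); last first.
  apply/funext => w; case E : (X N w);
    by apply: gloc => i _; rewrite /upd; case: eqP => // ->.
have mupd b : measurable_fun [set: T] (fun w => g (upd b (X ^~ w))).
  apply: (IH (g \o upd b)) => r r' rr' /=.
  apply: gloc => i; rewrite ltnS leq_eqVlt /upd.
  by case: eqP => //= _; exact: rr'.
by apply: measurable_fun_ifT => //; exact: measurable_funPT.
Qed.

(* The random variables W and Z of the game whose i-th round has outcome X i. *)
Section GameVariables.
Context d (T : measurableType d) (R : realType).
Variables (X : nat -> {mfun T >-> bool}) (n : nat).

Definition loser_score_rv : T -> nat := fun w => loser_score n (X ^~ w).

Definition net_profit_rv : T -> R := fun w => net_profit R n (X ^~ w).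

Lemma measurable_loser_score_rv : measurable_fun [set: T] loser_score_rv.
Proof. exact: (measurable_fun_local X (@loser_score_local n)). Qed.

Lemma measurable_net_profit_rv : measurable_fun [set: T] net_profit_rv.
Proof.
apply: (measurable_fun_local X (g := net_profit R n) (N := n.*2)) => r r' rr'.
exact: net_profit_local.
Qed.

HB.instance Definition _ :=
  isMeasurableFun.Build _ _ _ _ loser_score_rv measurable_loser_score_rv.

HB.instance Definition _ :=
  isMeasurableFun.Build _ _ _ _ net_profit_rv measurable_net_profit_rv.

End GameVariables.

Section AffineVariable.
Context d (T : measurableType d) (R : realType).
Variables (a b c : R) (Y : {mfun T >-> R}).

Definition affine_rv : T -> R := fun w => (a * Y w - b) / c.

Lemma measurable_affine_rv : measurable_fun [set: T] affine_rv.
Proof.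
by apply: measurable_funM => //; apply: measurable_funB => //;
  apply: measurable_funM => //; exact: measurable_funPT.
Qed.

HB.instance Definition _ :=
  isMeasurableFun.Build _ _ _ _ affine_rv measurable_affine_rv.

End AffineVariable.

Definition mutually_independent d d' (T : measurableType d)
    (T' : measurableType d') (R : realType) (P : probability T R)
    (I : choiceType) (X : I -> {RV P >-> T'}) : Prop :=
  forall (J : {fset I}) (B : I -> set T'),
    (forall i, measurable (B i)) ->
    P (\bigcap_(i in [set` J]) (X i @^-1` B i)) =
    (\prod_(i <- J) P (X i @^-1` B i))%E.

(* Convergence in distribution of real random variables to the law [nu]:
   convergence of the distribution functions at every continuity point of the
   distribution function of [nu]. *)
Definition cvg_in_distribution d (T : measurableType d) (R : realType)
    (P : probability T R) (X : nat -> {RV P >-> R})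
    (nu : probability (measurableTypeR R) R) : Prop :=
  forall x : R, {for x, continuous (fun y : R => nu `]-oo, y]%classic)} ->
    cdf (X n) x @[n --> \oo] --> nu `]-oo, x]%classic.

Arguments mutually_independent {d d' T T' R} P {I} X.
Arguments cvg_in_distribution {d T R} P X nu.

(* Main.v *)
Require Import Defs.
From HB Require Import structures.
From mathcomp Require Import all_boot all_order all_algebra finmap.
From mathcomp Require Import all_classical all_reals all_analysis.
From mathcomp Require Import measurable_realfun.
From mathcomp Require Import ring lra zify.
Import Order.TTheory GRing.Theory Num.Theory.
Import numFieldNormedType.Exports.

(* For 1 <= j <= n, Player 1 makes a profit of at least [j] exactly when she has
   won [n] of the first [2n - j] rounds, and symmetrically for Player 2.  The
   exact law of the loser's score follows, and the distribution function of the
   profit becomes a binomial one, so that (b) reduces to the central limit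
   theorem for the binomial law.

   That theorem is proved by Stein's method. Let [Phi] and [phi] be the normal
   distribution function and density. For a piecewise affine [h] that
   interpolates between 1 on ]-oo, a] and 0 on [b, +oo[, with integral [c]
   over [0, 1], the equation [g' w - w * g w = h (Phi w) - c] has an explicit
   solution [g], for which Mills' inequality gives a locally Lipschitz
   derivative. For a standardized binomial variable [S], [E (S * g S)] is the
   mean of a difference quotient of [g], hence close to [E (g' S)]; so [E (h
   (Phi S))] tends to [c], that is, [Phi S] is asymptotically uniform on [0,
   1]. *)

Set Implicit Arguments.
Unset Strict Implicit.

Local Open Scope classical_set_scope.
Local Open Scope ring_scope.

(** * Piecewise affine test functions and their primitives *)

Section PositivePart.
Context {R : realType}.
Implicit Types u v x : R.

Definition pospart (v : R) : R := Num.max v 0.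

(** The difference quotient is within [C * |h|] of [df]. This reduces the derivative of a piecewise
    defined function to an algebraic inequality, checked case by case. *)
Lemma quadratic_is_derive (f : R -> R) (x df C : R) : 0 < C ->
  (forall h, `|f (x + h) - f x - h * df| <= C * h ^+ 2) ->
  is_derive x 1 f df.
Proof.
move=> C0 H.
have L : h^-1 *: ((f \o shift x) (h *: 1) - f x) @[h --> 0^'] --> df.
  apply/cvgrPdist_le => e e0; near=> h.
  have h0 : h != 0 by near: h; exact: nbhs_dnbhs_neq.
  rewrite /= /GRing.scale/= mulr1 distrC (addrC h).
  have -> : h^-1 * (f (x + h) - f x) - df = h^-1 * (f (x + h) - f x - h * df).
    by field.
  rewrite normrM normfV ler_pdivrMl ?normr_gt0// (le_trans (H h))//.
  rewrite -real_normK ?num_real// expr2 mulrCA ler_pM2l ?normr_gt0//.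
  rewrite -ler_pdivlMl// mulrC.
  near: h; apply: dnbhs0_le; exact: divr_gt0.
by apply: DeriveDef; [apply/cvg_ex; exists df|exact: cvg_lim L].
Unshelve. all: by end_near. Qed.

Lemma is_derive_pospart_sqr x :
  is_derive x 1 (fun v : R => pospart v ^+ 2 / 2) (pospart x).
Proof.
apply: (@quadratic_is_derive _ _ _ 1) => // h.
rewrite /pospart; case: (leP (x + h) 0) => h1; case: (leP x 0) => h2;
  rewrite ler_norml; apply/andP; split; nra.
Qed.

Lemma pospart_lip u v : `|pospart u - pospart v| <= `|u - v|.
Proof.
rewrite /pospart; case: (leP u 0) => h1; case: (leP v 0) => h2;
  case: (ler0P (u - v)) => h3; rewrite ?ler_norml; try (apply/andP; split); lra.
Qed.

Lemma pospart_incr u v : u <= v ->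
  0 <= pospart v - pospart u <= v - u.
Proof.
by rewrite /pospart; case: (leP u 0) => h1; case: (leP v 0) => h2 h3;
  apply/andP; split; lra.
Qed.

Implicit Types a b : R.

Let sub_neq0 a b : a < b -> b - a != 0.
Proof. by move=> ab; rewrite subr_eq0 gt_eqF. Qed.

(** For [a < b] this is the interpolation [h] between 1 and 0; as a difference of positive parts it
    inherits their Lipschitz bound and their primitive. *)
Definition ramp a b u : R := (pospart (b - u) - pospart (a - u)) / (b - a).

(** The primitive of [ramp a b] that vanishes at 0, so that [ramp_prim a b 1] is the integral [c] of
    [h] over [0, 1]. *)
Definition ramp_prim a b u : R :=
  (pospart b ^+ 2 / 2 - pospart (b - u) ^+ 2 / 2
   - (pospart a ^+ 2 / 2 - pospart (a - u) ^+ 2 / 2)) / (b - a).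

Lemma ramp_ge0_le1 a b u : a < b -> 0 <= ramp a b u <= 1.
Proof.
move=> ab; have ba0 := sub_neq0 ab.
rewrite /ramp; have h : a - u <= b - u by lra.
have ba : 0 < b - a by lra.
have /andP[h1 h2] := pospart_incr h.
by rewrite divr_ge0 ?(ltW ba)//= ler_pdivrMr// mul1r; lra.
Qed.

Lemma ramp_eq1 a b u : a < b -> u <= a -> ramp a b u = 1.
Proof.
move=> ab; have ba0 := sub_neq0 ab; move=> ua; rewrite /ramp /pospart.
have [h1 h2] : 0 <= b - u /\ 0 <= a - u by split; lra.
by rewrite (max_l h1) (max_l h2); field.
Qed.

Lemma ramp_eq0 a b u : a < b -> b <= u -> ramp a b u = 0.
Proof.
move=> ab; have ba0 := sub_neq0 ab; move=> ua; rewrite /ramp /pospart.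
have [h1 h2] : b - u <= 0 /\ a - u <= 0 by split; lra.
by rewrite (max_r h1) (max_r h2) subrr mul0r.
Qed.

Lemma ramp_lip a b u v : a < b ->
  `|ramp a b u - ramp a b v| <= 2 / (b - a) * `|u - v|.
Proof.
move=> ab; have ba0 := sub_neq0 ab.
have ba : 0 < b - a by lra.
rewrite /ramp.
have -> : (pospart (b - u) - pospart (a - u)) / (b - a) -
  (pospart (b - v) - pospart (a - v)) / (b - a) =
  ((pospart (b - u) - pospart (b - v)) -
   (pospart (a - u) - pospart (a - v))) / (b - a) by field.
rewrite normrM normfV (gtr0_norm ba) mulrAC ler_pM2r ?invr_gt0//.
apply: (le_trans (ler_normB _ _)).
have := pospart_lip (b - u) (b - v); have := pospart_lip (a - u) (a - v).
have -> : b - u - (b - v) = - (u - v) by ring.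
have -> : a - u - (a - v) = - (u - v) by ring.
rewrite normrN; lra.
Qed.

Lemma is_derive_ramp_prim a b u : a < b ->
  is_derive u 1 (ramp_prim a b) (ramp a b u).
Proof.
move=> ab; have ba0 := sub_neq0 ab.
have D c : is_derive u 1 (fun v : R => pospart (c - v) ^+ 2 / 2)
    (- pospart (c - u)).
  have H := is_derive_pospart_sqr (c - u).
  have H2 : is_derive u 1 (fun v : R => c - v) (-1).
    by apply: is_derive_eq; ring.
  have := @is_derive1_comp _ (fun v => pospart v ^+ 2 / 2) (fun v => c - v)
    u _ _ H H2.
  by rewrite mulrN1.
have Da := D a; have Db := D b.
have H : is_derive u 1 ((b - a)^-1 \*:
    ((cst (pospart b ^+ 2 / 2) - (fun v : R => pospart (b - v) ^+ 2 / 2)) -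
     (cst (pospart a ^+ 2 / 2) - (fun v : R => pospart (a - v) ^+ 2 / 2))))
    ((b - a)^-1 *: (0 - - pospart (b - u) - (0 - - pospart (a - u)))).
  by apply: is_deriveZ.
have -> : ramp_prim a b = (b - a)^-1 \*:
    ((cst (pospart b ^+ 2 / 2) - (fun v : R => pospart (b - v) ^+ 2 / 2)) -
     (cst (pospart a ^+ 2 / 2) - (fun v : R => pospart (a - v) ^+ 2 / 2))).
  by apply/funext => w; rewrite /ramp_prim mulrC.
apply: is_derive_eq H _.
by rewrite /ramp /GRing.scale/=; field.
Qed.

Lemma derivable_continuous_within (f df : R -> R) (u v : R) :
  (forall x, is_derive x 1 f (df x)) -> {within `[u, v], continuous f}.
Proof.
move=> H; apply: continuous_subspaceT => x.
by apply/differentiable_continuous/derivable1_diffP; case: (H x).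
Qed.

Lemma ramp_prim0 a b : ramp_prim a b 0 = 0.
Proof. by rewrite /ramp_prim !subr0 !subrr mul0r. Qed.

Lemma ramp_prim_incr a b u v : a < b -> u <= v ->
  0 <= ramp_prim a b v - ramp_prim a b u <= v - u.
Proof.
move=> ab; have ba0 := sub_neq0 ab; move=> uv.
have [x _ ->] := MVT_segment uv (fun x _ => is_derive_ramp_prim x ab)
  (derivable_continuous_within (fun x => is_derive_ramp_prim x ab)).
have /andP[h1 h2] := ramp_ge0_le1 x ab.
by rewrite mulr_ge0 ?subr_ge0//= ler_piMl ?subr_ge0.
Qed.

(** On [0, 1], [ramp a b] is at most the indicator of []-oo, b]]; the resulting bound on the
    integral is read off the explicit formula. *)
Lemma ramp_prim1_le a b : a < b -> 0 <= a -> ramp_prim a b 1 <= b.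
Proof.
move=> ab; have ba0 := sub_neq0 ab; move=> a0.
rewrite /ramp_prim ler_pdivrMr ?subr_gt0// /pospart.
rewrite (max_l a0) (max_l (ltW (le_lt_trans a0 ab))).
by case: (leP (b - 1) 0) => h1; case: (leP (a - 1) 0) => h2; nra.
Qed.

(** Dually, [ramp a b] is at least the indicator of []-oo, a]]. *)
Lemma ramp_prim1_ge a b : a < b -> b <= 1 -> a <= ramp_prim a b 1.
Proof.
move=> ab; have ba0 := sub_neq0 ab; move=> b1; have [a0|a0] := leP a 0.
  have /andP[] := ramp_prim_incr ab ler01.
  by rewrite ramp_prim0 subr0 => h _; exact: le_trans h.
rewrite /ramp_prim ler_pdivlMr ?subr_gt0// /pospart.
rewrite (max_l (ltW a0)) (max_l (ltW (lt_trans a0 ab))) max_r ?max_r; nra.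
Qed.

End PositivePart.

(** * The normal distribution function and Mills' inequality *)

Section StandardNormal.
Context {R : realType}.
Implicit Types (x y w v : R).

Local Notation phi := (@normal_pdf R 0 1).

Definition gauss_cdf x : R := fine (normal_prob (0 : R) 1 `]-oo, x]).

Lemma normal_pdf01E x : phi x = normal_peak 1 * expR (- (x ^+ 2 / 2)).
Proof. by rewrite normal_pdfE ?oner_neq0// /normal_fun subr0 expr1n mulNr. Qed.

Lemma normal_pdf01_gt0 x : 0 < phi x.
Proof.
by rewrite normal_pdf01E mulr_gt0 ?expR_gt0 ?normal_peak_gt0 ?oner_neq0.
Qed.

Lemma is_derive_half_sqr x : is_derive x 1 (fun v : R => v ^+ 2 / 2) x.
Proof.
apply: (@quadratic_is_derive _ _ _ _ 1) => // h.
by rewrite ler_norml; apply/andP; split; nra.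
Qed.

Lemma is_derive_normal_pdf01 x : is_derive x 1 phi (- x * phi x).
Proof.
have H : is_derive x 1 (fun v : R => - (v ^+ 2 / 2)) (- x).
  exact: is_deriveN (is_derive_half_sqr x).
have H2 := @is_derive1_comp _ expR (fun v => - (v ^+ 2 / 2)) x _ _
  (is_derive_expR _) H.
have := is_deriveZ (normal_peak 1) H2.
have -> : normal_peak 1 \*: (expR \o (fun v => - (v ^+ 2 / 2))) = phi.
  by apply/funext => v; rewrite normal_pdf01E.
move=> H3; apply: is_derive_eq H3 _.
by rewrite normal_pdf01E /GRing.scale/=; ring.
Qed.

Let gauss_cdfE x : (gauss_cdf x)%:E = normal_prob (0 : R) 1 `]-oo, x].
Proof. by rewrite /gauss_cdf fineK// fin_num_measure. Qed.

Lemma is_derive_gauss_cdf x : is_derive x 1 gauss_cdf (phi x).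
Proof.
have [||||H1 H2] := @continuous_FTC1 R phi -oo%O x (x + 1).
- by rewrite ltrDl.
- exact: integrableS (@integrable_normal_pdf R 0 1).
- exact: ltNyr.
- by apply: continuous_normal_pdf; exact: oner_neq0.
by apply: DeriveDef; [exact: H1|rewrite -derive1E].
Qed.

Lemma gauss_cdf_ge0_le1 x : 0 <= gauss_cdf x <= 1.
Proof. by rewrite -!lee_fin gauss_cdfE measure_ge0 probability_le1. Qed.

Lemma le_gauss_cdf x y : x <= y -> gauss_cdf x <= gauss_cdf y.
Proof.
move=> xy; rewrite -lee_fin !gauss_cdfE le_measure ?inE//.
exact: subset_itvl.
Qed.

(** Under [normal_prob 0 1] the identity is a random variable with distribution function
    [gauss_cdf], which gives the limits at both infinities. *)
Let idR : measurableTypeR R -> R := idfun.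

HB.instance Definition _ :=
  @isMeasurableFun.Build _ _ _ _ idR (@measurable_id _ _ setT).

Lemma cvg_gauss_cdfNy : gauss_cdf x @[x --> -oo%R] --> (0 : R).
Proof.
have H := cvg_cdfNy0 (idR : {RV (@normal_prob R 0 1) >-> R}).
exact: (fine_cvg H).
Qed.

Lemma cvg_gauss_cdfy : gauss_cdf x @[x --> +oo%R] --> (1 : R).
Proof.
have H := cvg_cdfy1 (idR : {RV (@normal_prob R 0 1) >-> R}).
exact: (fine_cvg H).
Qed.

Lemma derivable_le_homo (f df : R -> R) x y : x <= y ->
  (forall v, x <= v <= y -> is_derive v 1 f (df v)) ->
  (forall v, x <= v <= y -> 0 <= df v) -> f x <= f y.
Proof.
move=> xy Df df0.
have [||c] := @MVT_segment _ f df x y xy.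
- by move=> v; rewrite in_itv/= => /andP[v1 v2]; apply: Df; rewrite !ltW.
- apply: derivable_within_continuous => v; rewrite in_itv/= => vxy.
  by case: (Df _ vxy).
rewrite in_itv/= => cxy.
by move/eqP; rewrite subr_eq => /eqP ->; rewrite lerDr mulr_ge0 ?subr_ge0 ?df0.
Qed.

(* [phi w / w] has derivative [- phi w - phi w / w ^ 2], which is below that
   of [1 - gauss_cdf w]; both functions vanish at infinity. *)
Let is_derive_mills w : w != 0 ->
  is_derive w 1 (fun v => phi v / v + gauss_cdf v) (- (phi w / w ^+ 2)).
Proof.
move=> w0.
have H1 := is_deriveM (is_derive_normal_pdf01 w)
  (is_deriveV w0 (is_derive_id w 1)).
have H2 := is_deriveD H1 (is_derive_gauss_cdf w).
by apply: is_derive_eq H2 _; rewrite /GRing.scale/=; field.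
Qed.

(** On the negative axis [phi w / w + gauss_cdf w] is nonincreasing, so a positive value at [w]
    would bound it from below at every [v <= w]; but far to the left [gauss_cdf v] drops below that
    value, and [phi v / v] is negative. *)
Lemma mills_left w : w < 0 -> - w * gauss_cdf w <= phi w.
Proof.
move=> w0; rewrite leNgt; apply/negP => h.
have e0 : 0 < phi w / w + gauss_cdf w.
  rewrite -(ltr_nM2r w0) mul0r mulrDl mulfVK ?lt_eqF//; lra.
have /cvgrPdist_lt/(_ _ e0)[M [_ HM]] := cvg_gauss_cdfNy.
pose v := Num.min (M - 1) w.
have vw : v <= w by rewrite ge_min lexx orbT.
have v0 : v < 0 by exact: le_lt_trans vw w0.
have := HM v; rewrite gt_min ltrBlDr ltrDl ltr01 => /(_ isT).
rewrite sub0r normrN ger0_norm; last by case/andP: (gauss_cdf_ge0_le1 v).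
have : - (phi v / v + gauss_cdf v) <= - (phi w / w + gauss_cdf w).
  apply: (@derivable_le_homo (fun v => - (phi v / v + gauss_cdf v))
    (fun x => - - (phi x / x ^+ 2))) => // x /andP[_ xw].
    apply: is_deriveN; apply: is_derive_mills.
    by rewrite lt_eqF// (le_lt_trans xw).
  by rewrite opprK divr_ge0 ?normal_pdf_ge0// sqr_ge0.
have : phi v / v < 0 by rewrite pmulr_rlt0 ?normal_pdf01_gt0// invr_lt0.
lra.
Qed.

(** The mirror argument on the positive axis, where the same function is nonincreasing and
    [gauss_cdf] tends to 1. *)
Lemma mills_right w : 0 < w -> w * (1 - gauss_cdf w) <= phi w.
Proof.
move=> w0; rewrite leNgt; apply/negP => h.
have e0 : 0 < 1 - gauss_cdf w - phi w / w.
  by rewrite subr_gt0 ltr_pdivrMr// mulrC.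
have /cvgrPdist_lt/(_ _ e0)[M [_ HM]] := cvg_gauss_cdfy.
pose v := Num.max (M + 1) w.
have vw : w <= v by rewrite le_max lexx orbT.
have v0 : 0 < v by exact: lt_le_trans w0 vw.
have := HM v; rewrite lt_max ltrDl ltr01 => /(_ isT).
rewrite ger0_norm; last by rewrite subr_ge0; case/andP: (gauss_cdf_ge0_le1 v).
have : - (phi w / w + gauss_cdf w) <= - (phi v / v + gauss_cdf v).
  apply: (@derivable_le_homo (fun v => - (phi v / v + gauss_cdf v))
    (fun x => - - (phi x / x ^+ 2))) => // x /andP[wx _].
    apply: is_deriveN; apply: is_derive_mills.
    by rewrite gt_eqF// (lt_le_trans w0).
  by rewrite opprK divr_ge0 ?normal_pdf_ge0// sqr_ge0.
have : 0 < phi v / v by rewrite divr_gt0 ?normal_pdf01_gt0.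
lra.
Qed.

End StandardNormal.

(** * The solution of the Stein equation and bounds on its derivative *)

Section SteinEquation.
Context {R : realType}.
Implicit Types (a b v w : R).

Local Notation phi := (@normal_pdf R 0 1).
Local Notation Phi := (@gauss_cdf R).

(** By the substitution [u = Phi t], the numerator is the integral of [(h (Phi t) - c) * phi t] over
    []-oo, w]]: this is the classical solution. *)
Definition stein_sol a b w : R :=
  (ramp_prim a b (Phi w) - ramp_prim a b 1 * Phi w) / phi w.

(** The derivative as the Stein equation prescribes it. *)
Definition stein_sol' a b w : R :=
  w * stein_sol a b w + (ramp a b (Phi w) - ramp_prim a b 1).

Lemma is_derive_stein_sol a b w : a < b ->
  is_derive w 1 (stein_sol a b) (stein_sol' a b w).
Proof.
move=> ab; have p0 : phi w != 0 by rewrite gt_eqF// normal_pdf01_gt0.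
have D := is_derive_gauss_cdf w.
have H1 := @is_derive1_comp _ (ramp_prim a b) Phi w _ _
  (is_derive_ramp_prim _ ab) D.
have H2 := is_deriveB H1 (is_deriveZ (ramp_prim a b 1) D).
have H3 := is_deriveM H2 (is_deriveV p0 (is_derive_normal_pdf01 w)).
apply: is_derive_eq H3 _.
by rewrite /stein_sol' /stein_sol !fctE/= /GRing.scale/=; field.
Qed.

(** With [t = Phi w], [U] and [V] the values of [ramp_prim] at [t] and 1, the numerator is
    [U * (1 - t) - (V - U) * t], where [0 <= U <= t] and [0 <= V - U <= 1 - t]. *)
Let num_le a b w : a < b ->
  `|ramp_prim a b (Phi w) - ramp_prim a b 1 * Phi w| <=
  Num.min (Phi w) (1 - Phi w).
Proof.
move=> ab; have /andP[u0 u1] := gauss_cdf_ge0_le1 w.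
have /andP[] := ramp_prim_incr ab u0; have /andP[] := ramp_prim_incr ab u1.
have /andP[] := ramp_prim_incr ab (@ler01 R).
rewrite ramp_prim0 !subr0.
set U := ramp_prim _ _ _; set V := ramp_prim _ _ _; set t := Phi w in u0 u1 *.
move=> *; rewrite le_min !ler_norml; apply/andP; split; apply/andP; split; nra.
Qed.

(** The bound of the numerator by [Phi w] is paired with Mills' inequality on the left, the bound by
    [1 - Phi w] with that on the right. *)
Lemma stein_sol_mul_le1 a b w : a < b -> `|w * stein_sol a b w| <= 1.
Proof.
move=> ab; have p0 := normal_pdf01_gt0 w; have := num_le w ab.
rewrite /stein_sol le_min => /andP[h1 h2].
rewrite !normrM normfV (gtr0_norm p0) mulrA ler_pdivrMr// mul1r.
have [w0|w0|->] := ltgtP w 0.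
- by apply: le_trans (mills_left w0); rewrite ltr0_norm// ler_pM2l// oppr_gt0.
- by apply: le_trans (mills_right w0); rewrite gtr0_norm// ler_pM2l.
- by rewrite normr0 mul0r ltW ?normal_pdf01_gt0.
Qed.

(** Where [|w| >= 1] the bound on [w * stein_sol a b w] suffices; elsewhere the numerator is at most
    1 and [phi w >= phi 1]. *)
Lemma stein_sol_bounded a b w : a < b -> `|stein_sol a b w| <= 1 + (phi 1)^-1.
Proof.
move=> ab; have p1 : 0 < (phi 1)^-1 by rewrite invr_gt0 normal_pdf01_gt0.
have [w1|w1] := leP 1 `|w|.
  have := stein_sol_mul_le1 w ab; rewrite normrM.
  have := normr_ge0 (stein_sol a b w); nra.
have h : phi 1 <= phi w.
  rewrite !normal_pdf01E ler_pM2l ?normal_peak_gt0 ?oner_neq0//.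
  rewrite ler_expR lerN2 ler_pM2r// expr1n -real_normK ?num_real//.
  by rewrite expr_le1// ltW.
have := num_le w ab; rewrite le_min => /andP[h1 _].
have /andP[_ u1] := gauss_cdf_ge0_le1 w.
rewrite /stein_sol normrM normfV (gtr0_norm (normal_pdf01_gt0 w)).
apply: (@le_trans _ _ (phi 1)^-1); last by rewrite lerDr.
rewrite -[leRHS]mul1r ler_pM// ?invr_ge0 ?normal_pdf_ge0//.
  exact: le_trans u1.
by rewrite lef_pV2 ?posrE ?normal_pdf01_gt0.
Qed.

Lemma stein_sol'_le2 a b w : a < b -> `|stein_sol' a b w| <= 2.
Proof.
move=> ab; have := stein_sol_mul_le1 w ab.
have /andP[] := ramp_prim_incr ab (@ler01 R).
have /andP[] := ramp_ge0_le1 (Phi w) ab.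
rewrite /stein_sol' ramp_prim0 !subr0 !ler_norml.
move=> ? ? ? ? /andP[? ?]; apply/andP; split; lra.
Qed.

(** The derivative is bounded on an interval that contains the segment and is symmetric in [v] and
    [w], so the two may be ordered freely. *)
Lemma MVT_norm_le (f df : R -> R) (C : R) v w :
  (forall x : R, is_derive x 1 f (df x)) ->
  (forall x, `|x| <= `|v| + `|w| -> `|df x| <= C) ->
  `|f v - f w| <= C * `|v - w|.
Proof.
move=> Df dfC; wlog vw : v w dfC / w <= v.
  move=> H; have [|/ltW] := leP w v; first exact: H.
  by rewrite distrC (distrC v); apply: H => x xwv; apply: dfC; rewrite addrC.
have [x xwv ->] := MVT_segment vw (fun x _ => Df x)
  (derivable_continuous_within Df).
rewrite normrM ler_wpM2r// dfC//.
move: xwv; rewrite in_itv/= => /andP[wx xv].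
have := ler_norm v; have := ler_norm (- w); rewrite normrN.
have := normr_ge0 v; have := normr_ge0 w.
by case: (ler0P x) => ?; lra.
Qed.

(** The sum of a Lipschitz constant of [h] composed with [Phi], a bound on [stein_sol] and a bound
    on [stein_sol']. *)
Definition stein_const a b : R :=
  2 / (b - a) * normal_peak 1 + 1 + (phi 1)^-1 + 2.

Lemma stein_const_ge2 a b : a < b -> 2 <= stein_const a b.
Proof.
move=> ab; rewrite /stein_const lerDr !addr_ge0// ?invr_ge0 ?normal_pdf_ge0//.
by rewrite mulr_ge0 ?normal_peak_ge0// divr_ge0// subr_ge0 ltW.
Qed.

(** Of the two varying summands of [stein_sol'], [h (Phi w)] is globally Lipschitz, while [w * g w]
    has derivative [g w + w * g' w], which grows at most linearly; hence the factor
    [1 + |v| + |w|]. *)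
Lemma stein_sol'_lip a b v w : a < b ->
  `|stein_sol' a b v - stein_sol' a b w| <=
  stein_const a b * (1 + `|v| + `|w|) * `|v - w|.
Proof.
move=> ab; have pk := @normal_peak_ge0 R 1.
have ba : 0 < b - a by rewrite subr_gt0.
have HPhi : `|Phi v - Phi w| <= normal_peak 1 * `|v - w|.
  apply: (@MVT_norm_le Phi phi) => x; first exact: is_derive_gauss_cdf.
  move=> _; rewrite ger0_norm ?normal_pdf_ge0//.
  by apply: normal_pdf_ub; exact: oner_neq0.
have Hramp : `|ramp a b (Phi v) - ramp a b (Phi w)| <=
    2 / (b - a) * normal_peak 1 * `|v - w|.
  apply: le_trans (ramp_lip _ _ ab) _.
  by rewrite -[leRHS]mulrA ler_wpM2l// divr_ge0// ltW.
have Hg : `|v * stein_sol a b v - w * stein_sol a b w| <=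
    (1 + (phi 1)^-1 + 2 * (`|v| + `|w|)) * `|v - w|.
  apply: (@MVT_norm_le (fun x => x * stein_sol a b x)
    (fun x => stein_sol a b x + x * stein_sol' a b x)) => x.
    apply: is_derive_eq (is_deriveM (is_derive_id x 1)
      (is_derive_stein_sol x ab)) _.
    by rewrite /GRing.scale/=; ring.
  move=> xvw; apply: le_trans (ler_normD _ _) _.
  apply: lerD; first exact: stein_sol_bounded.
  by rewrite normrM mulrC ler_pM// stein_sol'_le2.
have -> : stein_sol' a b v - stein_sol' a b w =
  (v * stein_sol a b v - w * stein_sol a b w) +
  (ramp a b (Phi v) - ramp a b (Phi w)) by rewrite /stein_sol'; ring.
apply: le_trans (ler_normD _ _) _; apply: le_trans (lerD Hg Hramp) _.
rewrite -mulrDl ler_wpM2r// /stein_const.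
set L := 2 / _ * _; set C := _^-1.
have L0 : 0 <= L by rewrite mulr_ge0// divr_ge0// ltW.
have C0 : 0 <= C by rewrite invr_ge0 normal_pdf_ge0.
have := normr_ge0 v; have := normr_ge0 w; nra.
Qed.

End SteinEquation.

(** * Binomial means and the central limit theorem *)

Section BinomialMean.
Context {R : realType}.
Variable p : R.
Implicit Types (f g : nat -> R) (m k : nat) (a b : R).

(* The mean of [f (S m)], where [S m] is the number of successes among [m]
   independent trials of success probability [p]. *)
Fixpoint bmean (m : nat) (f : nat -> R) : R :=
  if m is m'.+1 then p * bmean m' (f \o S) + (1 - p) * bmean m' f else f 0%N.

Lemma eq_bmean m f g : f =1 g -> bmean m f = bmean m g.
Proof.
elim: m f g => [|m IH] f g fg /=; first exact: fg.
by congr (_ * _ + _ * _); apply: IH => k /=; exact: fg.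
Qed.

Lemma bmean_cst m (c : R) : bmean m (fun=> c) = c.
Proof. by elim: m => //= m IH; rewrite [X in p * X]IH IH; ring. Qed.

Lemma bmeanD m f g : bmean m (fun k => f k + g k) = bmean m f + bmean m g.
Proof.
elim: m f g => //= m IH f g.
by rewrite IH (IH (f \o S) (g \o S)); ring.
Qed.

Lemma bmeanZ m (c : R) f : bmean m (fun k => c * f k) = c * bmean m f.
Proof.
elim: m f => //= m IH f.
by rewrite IH (IH (f \o S)); ring.
Qed.

Lemma bmeanB m f g : bmean m (fun k => f k - g k) = bmean m f - bmean m g.
Proof.
rewrite -mulN1r -bmeanZ -bmeanD; apply: eq_bmean => k; ring.
Qed.

(** The Stein identity of the binomial law: centring turns into a difference operator with one trial
    fewer. One trial is conditioned upon, both conditional means are recentred ([E1], [E2]), and the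
    induction hypothesis applies to [f] and to its shift. *)
Lemma bmean_stein m f :
  bmean m.+1 (fun k => (k%:R - m.+1%:R * p) * f k) =
  m.+1%:R * p * (1 - p) * bmean m (fun k => f k.+1 - f k).
Proof.
elim: m f => [|m IH] f; first by rewrite /=; ring.
have E1 : bmean m.+1 ((fun k => (k%:R - m.+2%:R * p) * f k) \o S) =
    bmean m.+1 (fun k => (k%:R - m.+1%:R * p) * f k.+1) +
    (1 - p) * bmean m.+1 (fun k => f k.+1).
  rewrite -bmeanZ -bmeanD; apply: eq_bmean => k /=.
  by rewrite -!natr1; ring.
have E2 : bmean m.+1 (fun k => (k%:R - m.+2%:R * p) * f k) =
    bmean m.+1 (fun k => (k%:R - m.+1%:R * p) * f k) - p * bmean m.+1 f.
  rewrite -bmeanZ -bmeanB; apply: eq_bmean => k.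
  by rewrite -(natr1 m.+1); ring.
rewrite {1}/bmean -/bmean.
rewrite -[p * _]/(p * bmean m.+1 ((fun k => (k%:R - m.+2%:R * p) * f k) \o S)).
rewrite -[X in _ + (1 - p) * X]/(bmean m.+1
  (fun k => (k%:R - m.+2%:R * p) * f k)).
rewrite E1 E2 !IH !bmeanB /=.
rewrite -[bmean m (fun k => f k.+2)]/(bmean m ((fun k => f k.+1) \o S)).
rewrite -[bmean m (f \o S)]/(bmean m (fun k => f k.+1)) -(natr1 m.+1).
ring.
Qed.

Hypothesis p01 : 0 < p < 1.

Let p0 : 0 < p. Proof. by case/andP: p01. Qed.
Let q0 : 0 < 1 - p. Proof. by rewrite subr_gt0; case/andP: p01. Qed.

Lemma le_bmean m f g : (forall k, f k <= g k) -> bmean m f <= bmean m g.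
Proof.
elim: m f g => [|m IH] f g fg /=; first exact: fg.
by apply: lerD; (apply: ler_wpM2l; first exact: ltW); apply: IH => k /=.
Qed.

Lemma bmean_norm_le m f g : (forall k, `|f k| <= g k) ->
  `|bmean m f| <= bmean m g.
Proof.
move=> fg; rewrite ler_norml -mulN1r -bmeanZ; apply/andP; split;
  apply: le_bmean => k; have := fg k; rewrite ler_norml => /andP[]; lra.
Qed.

Definition bstd m k : R := (k%:R - m%:R * p) / Num.sqrt (m%:R * p * (1 - p)).

Let s_gt0 m : 0 < Num.sqrt (m.+1%:R * p * (1 - p)).
Proof. by rewrite sqrtr_gt0 !mulr_gt0. Qed.

Let s_sqr m : Num.sqrt (m.+1%:R * p * (1 - p)) ^+ 2 = m.+1%:R * p * (1 - p).
Proof. by rewrite sqr_sqrtr// ltW// !mulr_gt0. Qed.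

Let bstdS m k :
  bstd m.+1 k.+1 = bstd m.+1 k + (Num.sqrt (m.+1%:R * p * (1 - p)))^-1.
Proof.
have s0 := s_gt0 m; rewrite /bstd; set s := Num.sqrt _ in s0 *.
by rewrite -(natr1 k); field; rewrite gt_eqF.
Qed.

Lemma bmean_bstd_stein m f :
  bmean m.+1 (fun k => bstd m.+1 k * f k) =
  Num.sqrt (m.+1%:R * p * (1 - p)) * bmean m (fun k => f k.+1 - f k).
Proof.
have s0 := s_gt0 m; have s2 := s_sqr m.
have -> : bmean m.+1 (fun k => bstd m.+1 k * f k) =
    (Num.sqrt (m.+1%:R * p * (1 - p)))^-1 *
    bmean m.+1 (fun k => (k%:R - m.+1%:R * p) * f k).
  by rewrite -bmeanZ; apply: eq_bmean => k; rewrite /bstd; ring.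
rewrite bmean_stein; set s := Num.sqrt _ in s0 s2 *; rewrite -s2.
by field; rewrite gt_eqF.
Qed.

(** The Stein identity for [f = bstd m.+1], whose increments are constant. *)
Lemma bmean_bstd_sqr m : bmean m.+1 (fun k => bstd m.+1 k ^+ 2) = 1.
Proof.
under eq_bmean do rewrite expr2.
rewrite bmean_bstd_stein.
under eq_bmean do rewrite bstdS addrAC subrr add0r.
by rewrite bmean_cst mulfV// gt_eqF.
Qed.

(** Conditioning the unit second moment on one trial and dropping the nonnegative success term
    leaves [1 - p] times this mean. *)
Lemma bmean_bstd_sqr_pred m :
  bmean m (fun k => bstd m.+1 k ^+ 2) <= (1 - p)^-1.
Proof.
rewrite -[leRHS]mulr1 ler_pdivlMl// -[leRHS](bmean_bstd_sqr m) /=.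
rewrite lerDr mulr_ge0 ?(ltW p0)// -(bmean_cst m 0).
by apply: le_bmean => k /=; exact: sqr_ge0.
Qed.

Lemma bmean_ramp_dist m a b : a < b ->
  1 <= Num.sqrt (m.+1%:R * p * (1 - p)) ->
  `|bmean m.+1 (fun k => ramp a b (gauss_cdf (bstd m.+1 k))) - ramp_prim a b 1|
  <= stein_const a b * (4 + (1 - p)^-1) / Num.sqrt (m.+1%:R * p * (1 - p)).
Proof.
move=> ab; have s0 := s_gt0 m; have S := bstdS m.
have st := bmean_bstd_stein m; have v := bmean_bstd_sqr_pred m.
move: s0 S st v; set s := Num.sqrt _ => s0 S st v s1.
have C0 : 0 <= stein_const a b by apply: le_trans (stein_const_ge2 ab).
have d0 : 0 < s^-1 by rewrite invr_gt0.
have d1 : s^-1 <= 1 by rewrite invf_le1.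
pose w k := bstd m.+1 k.
(* The Stein equation gives [E (g' S) - E (S * g S)]; conditioning on one trial and the Stein
   identity bring both terms to means over [m] trials. *)
have -> : bmean m.+1 (fun k => ramp a b (gauss_cdf (w k))) - ramp_prim a b 1 =
    bmean m (fun k => p * stein_sol' a b (w k.+1) +
      (1 - p) * stein_sol' a b (w k)
      - s * (stein_sol a b (w k.+1) - stein_sol a b (w k))).
  rewrite bmeanB bmeanZ -(st (fun k => stein_sol a b (w k))) bmeanD !bmeanZ.
  rewrite -[p * _ + _]/(bmean m.+1 (fun k => stein_sol' a b (w k))) -bmeanB.
  rewrite -[in LHS](bmean_cst m.+1 (ramp_prim a b 1)) -bmeanB.
  by apply: eq_bmean => k; rewrite /stein_sol' /w; ring.
apply: (@le_trans _ _ (bmean m (fun k =>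
    stein_const a b * (4 + w k ^+ 2) / s))); last first.
  have -> : bmean m (fun k => stein_const a b * (4 + w k ^+ 2) / s) =
      stein_const a b / s * (4 + bmean m (fun k => w k ^+ 2)).
    rewrite -{2}(bmean_cst m 4) -bmeanD -bmeanZ.
    by apply: eq_bmean => k; ring.
  rewrite [leRHS]mulrAC ler_wpM2l ?lerD2l//.
  by rewrite mulr_ge0// ltW.
apply: bmean_norm_le => k; rewrite /w S; set x := bstd m.+1 k.
have xx : x <= x + s^-1 by rewrite lerDl ltW.
(* The increment of [g] over a step of length [s^-1] is [g' y / s], so the factor [s] cancels and
   only differences of [g'] within one step remain. *)
have [y + ->] := MVT_segment xx (fun x _ => is_derive_stein_sol x ab)
  (derivable_continuous_within (fun x => is_derive_stein_sol x ab)).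
rewrite in_itv/= => /andP[y1 y2].
have -> : s * (stein_sol' a b y * (x + s^-1 - x)) = stein_sol' a b y.
  by field; rewrite gt_eqF.
have E : forall z, x <= z <= x + s^-1 ->
    `|stein_sol' a b z - stein_sol' a b y| <=
    stein_const a b * (4 + x ^+ 2) / s.
  move=> z /andP[z1 z2]; apply: le_trans (stein_sol'_lip _ _ ab) _.
  rewrite -!mulrA ler_wpM2l//.
  have bnd t : x <= t -> t <= x + s^-1 -> `|t| <= `|x| + s^-1.
    move=> t1 t2; have := ler_norm x; have := ler_norm (- x).
    by rewrite normrN ler_norml => *; apply/andP; split; lra.
  apply: ler_pM => //.
    (* Since [s^-1 <= 1], [1 + |z| + |y| <= 3 + 2 * |x| <= 4 + x ^+ 2]. *)
    have := bnd _ y1 y2; have := bnd _ z1 z2.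
    rewrite -(real_normK (num_real x)).
    have := sqr_ge0 (`|x| - 1); nra.
  by rewrite ler_norml; apply/andP; split; lra.
have -> : p * stein_sol' a b (x + s^-1) + (1 - p) * stein_sol' a b x -
    stein_sol' a b y = p * (stein_sol' a b (x + s^-1) - stein_sol' a b y) +
    (1 - p) * (stein_sol' a b x - stein_sol' a b y) by ring.
apply: le_trans (ler_normD _ _) _.
rewrite !normrM (gtr0_norm p0) (gtr0_norm q0).
have := E x; have := E (x + s^-1); rewrite !lexx xx => /(_ isT) h1 /(_ isT) h2.
have := p0; have := q0; nra.
Qed.

(** By monotonicity of [gauss_cdf], the indicator of [i <= k n] lies between two ramps in
    [gauss_cdf (bstd (m n) i)], placed just below and just above the level [gauss_cdf y]. *)
Lemma de_moivre_laplace (m k : nat -> nat) (y : R) :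
  m n @[n --> \oo] --> \oo ->
  bstd (m n) (k n) @[n --> \oo] --> y ->
  bmean (m n) (fun i => (i <= k n)%N%:R) @[n --> \oo] --> gauss_cdf y.
Proof.
move=> moo ky; apply/cvgrPdist_le => e e0.
have cPhi : {for y, continuous (@gauss_cdf R)}.
  by apply/differentiable_continuous/derivable1_diffP;
    case: (is_derive_gauss_cdf y).
have Phi_cvg : gauss_cdf (bstd (m n) (k n)) @[n --> \oo] --> gauss_cdf y.
  exact: cvg_comp ky cPhi.
have e40 : 0 < e / 4 by rewrite divr_gt0.
(* The margin [e / 4] absorbs the gap between [gauss_cdf (bstd (m n) (k n))] and [gauss_cdf y]; the
   integrals are off by at most [e / 2], which leaves [e / 2] for the Stein error. *)
pose a1 := gauss_cdf y + e / 4; pose b1 := gauss_cdf y + e / 2.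
pose a2 := gauss_cdf y - e / 2; pose b2 := gauss_cdf y - e / 4.
have ab1 : a1 < b1 by rewrite /a1 /b1; lra.
have ab2 : a2 < b2 by rewrite /a2 /b2; lra.
have /andP[G0 G1] := gauss_cdf_ge0_le1 y.
have c1 : ramp_prim a1 b1 1 <= b1.
  by apply: ramp_prim1_le => //; rewrite /a1; lra.
have c2 : a2 <= ramp_prim a2 b2 1.
  by apply: ramp_prim1_ge => //; rewrite /b2; lra.
pose C a b := stein_const a b * (4 + (1 - p)^-1).
(* A lower bound for the standard deviation that makes both Stein errors at most [e / 2], and is at
   least 1 as [bmean_ramp_dist] requires. *)
pose M := 1 + 2 * `|C a1 b1| / e + 2 * `|C a2 b2| / e.
have M1 : 1 <= M by rewrite /M -addrA lerDl addr_ge0// divr_ge0 ?mulr_ge0// ltW.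
have MC a b : `|C a b| <= M * e / 2 ->
  forall s, M <= s -> C a b / s <= e / 2.
  move=> h s Ms; have s0 : 0 < s by lra.
  rewrite ler_pdivrMr//; have := ler_norm (C a b); nra.
have MC1 := MC a1 b1; have MC2 := MC a2 b2.
have M2 : M * e / 2 = e / 2 + `|C a1 b1| + `|C a2 b2|.
  by rewrite /M; field; rewrite gt_eqF.
have /MC1{}MC1 : `|C a1 b1| <= M * e / 2.
  by rewrite M2; have := normr_ge0 (C a2 b2); lra.
have /MC2{}MC2 : `|C a2 b2| <= M * e / 2.
  by rewrite M2; have := normr_ge0 (C a1 b1); lra.
have Moo : \forall n \near \oo, M ^+ 2 / (p * (1 - p)) <= (m n)%:R.
  exact: (moo _ (nbhs_infty_ger (M ^+ 2 / (p * (1 - p))))).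
near=> n.
have : M ^+ 2 / (p * (1 - p)) <= (m n)%:R by near: n.
have : `|gauss_cdf y - gauss_cdf (bstd (m n) (k n))| <= e / 4.
  by near: n; move/cvgrPdist_le : Phi_cvg; exact.
case: (m n) => [|m'].
  have M0 : 0 < M by lra.
  by move=> _; rewrite leNgt divr_gt0 ?exprn_gt0// mulr_gt0.
rewrite ler_norml => /andP[k1 k2] sM.
have {}sM : M <= Num.sqrt (m'.+1%:R * p * (1 - p)).
  rewrite -(@ler_pXn2r _ 2)// ?nnegrE ?sqrtr_ge0//; last lra.
  by rewrite s_sqr -mulrA -ler_pdivrMr// mulr_gt0.
have := le_trans (bmean_ramp_dist ab1 (le_trans M1 sM)) (MC1 _ sM).
have := le_trans (bmean_ramp_dist ab2 (le_trans M1 sM)) (MC2 _ sM).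
rewrite !ler_norml => /andP[h3 h4] /andP[h5 h6].
have s0 := s_gt0 m'.
have mono i j : (i <= j)%N ->
    gauss_cdf (bstd m'.+1 i) <= gauss_cdf (bstd m'.+1 j).
  move=> ij; apply: le_gauss_cdf.
  by rewrite /bstd ler_pM2r ?invr_gt0// lerD2r ler_nat.
have up : bmean m'.+1 (fun i => (i <= k n)%N%:R) <=
   bmean m'.+1 (fun i => ramp a1 b1 (gauss_cdf (bstd m'.+1 i))).
  apply: le_bmean => i.
  have /andP[r0 _] := ramp_ge0_le1 (gauss_cdf (bstd m'.+1 i)) ab1.
  have [ik|//] := leqP i (k n).
  rewrite ramp_eq1//; apply: le_trans (mono _ _ ik) _; rewrite /a1; lra.
have lo : bmean m'.+1 (fun i => ramp a2 b2 (gauss_cdf (bstd m'.+1 i))) <=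
   bmean m'.+1 (fun i => (i <= k n)%N%:R).
  apply: le_bmean => i.
  have /andP[_ r1] := ramp_ge0_le1 (gauss_cdf (bstd m'.+1 i)) ab2.
  have [//|ki] := leqP i (k n).
  rewrite ramp_eq0//; apply: le_trans _ (mono _ _ (ltnW ki)); rewrite /b2; lra.
have b1E : b1 = gauss_cdf y + e / 2 by [].
have a2E : a2 = gauss_cdf y - e / 2 by [].
apply/andP; split; lra.
Unshelve. all: by end_near. Qed.

End BinomialMean.

(** * Combinatorics of the first-to-reach-[n] game *)

Section FirstToReach.
Local Open Scope nat_scope.
Implicit Types (b : bool) (r : nat -> bool) (m n k j : nat).

Lemma wins_le b r m m' : m <= m' -> wins b r m <= wins b r m'.
Proof.
move=> mm'; rewrite -(subnKC mm').
elim: (m' - m) => [|l IH]; first by rewrite addn0.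
by rewrite addnS winsS (leq_trans IH) ?leq_addr.
Qed.

Lemma wins_sumb b r m : wins b r m + wins (~~ b) r m = m.
Proof. by case: b; [|rewrite addnC]; exact: wins_sum. Qed.

(** Before the last round both scores are below [n], and a round adds a win to one player only, so
    the two cannot reach [n] together. *)
Lemma duration_wins n r : 0 < n -> exists b,
  [/\ wins b r (duration n r) = n, wins (~~ b) r (duration n r) < n &
      forall m, m < duration n r -> wins b r m < n /\ wins (~~ b) r m < n].
Proof.
move=> n0; rewrite /duration; case: ex_minnP => m go mmin.
have lt m' : m' < m -> forall b, wins b r m' < n.
  elim: m' => [|m' IH] m'm b; first by rewrite /wins big_ord0.
  have : ~~ game_over n r m'.+1.
    by apply/negP => /mmin; rewrite leqNgt m'm.
  rewrite /game_over negb_or => /andP[n1 n2].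
  rewrite ltn_neqAle; apply/andP; split; first by case: b.
  rewrite winsS (leq_trans _ (IH (ltnW m'm) b))// -addn1 leq_add2l.
  by case: (_ == _).
have [m0|m0] := posnP m.
  by move: go n0; rewrite m0 /game_over /wins !big_ord0 orbb => /eqP <-.
have step b : wins b r m <= n.
  rewrite -(prednK m0) winsS (leq_trans _ (lt m.-1 _ b)) ?prednK//.
  by rewrite -addn1 leq_add2l; case: (_ == _).
have nb b : wins b r m = n -> wins (~~ b) r m < n.
  move=> wb; rewrite ltnNge; apply/negP => h.
  have hm : m.-1 < m by rewrite prednK.
  have h1 := lt _ hm b; have h2 := lt _ hm (~~ b).
  move: wb h; rewrite -(prednK m0) !winsS.
  by case: (r _); case: b h1 h2 => /= h1 h2; rewrite ?addn0 => h3;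
    rewrite ?addn0 leqNgt ?h1 ?h2 //; move: h1 h2; rewrite -?h3 ?ltnn.
by case/orP: go => /eqP wb; [exists true|exists false]; split=> //;
  try exact: nb; move=> m' m'm; split; exact: lt.
Qed.

Lemma game_result b n r : wins b r (duration n r) = n ->
  wins (~~ b) r (duration n r) < n ->
  [/\ won n b r, won n (~~ b) r = false &
      loser_score n r = wins (~~ b) r (duration n r)].
Proof.
move=> wb wnb.
have h : won n (~~ b) r = false by rewrite /won ltn_eqF.
have h' : won n b r by rewrite /won wb.
by split=> //; rewrite /loser_score; case: b wb wnb h h' => /= _ _ h h';
  rewrite ?h' ?h.
Qed.

(** If [b] wins against at most [n - j], the game lasts at most [2n - j] rounds, and later rounds
    keep the [n] wins. If the opponent wins, either the game is still running after [2n - j] rounds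
    or at most [n - j < n] of these rounds are left for [b]. *)
Lemma won_wins_ge b n r j : 0 < j <= n ->
  (won n b r && (loser_score n r <= n - j)) = (n <= wins b r (n.*2 - j)).
Proof.
case/andP=> j0 jn; have n0 : 0 < n by exact: leq_trans jn.
have [b' [e1 e2 e3]] := duration_wins r n0.
have [w1 w2 ls] := game_result e1 e2.
have s := wins_sumb b' r (duration n r).
have [->|] := eqVneq b b'.
  rewrite w1 /= ls; apply/idP/idP => h.
    rewrite -{1}e1; apply: wins_le; rewrite -s e1; lia.
  have dur : duration n r <= n.*2 - j.
    rewrite leqNgt; apply/negP => /e3[]; lia.
  lia.
move=> bb'; have -> : b = ~~ b' by move: bb'; clear; case: b b' => -[].
rewrite w2 /=; apply/esym/negbTE; rewrite -ltnNge.
have [d|d] := ltnP (n.*2 - j) (duration n r); first by case: (e3 _ d).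
have := wins_le b' r d; have := wins_sumb b' r (n.*2 - j); lia.
Qed.

(** The winner's [n]-th win must fall exactly in round [n + k], which has index [(n + k).-1]. *)
Lemma won_loser_score b n r k : k < n ->
  (won n b r && (loser_score n r == k)) =
  (wins b r (n + k).-1 == n.-1) && (r (n + k).-1 == b).
Proof.
move=> kn; have n0 : 0 < n by exact: leq_trans kn.
(* A score of exactly [k] is at most [k] but not at most [k.-1]; the guard [0 < k] is there because
   for [k = 0] nothing has to be excluded. *)
have -> : (won n b r && (loser_score n r == k)) =
  (n <= wins b r (n + k)) && ~~ ((0 < k) && (n <= wins b r (n + k).-1)).
  have h1 := @won_wins_ge b n r (n - k).
  have h2 := @won_wins_ge b n r (n - k.-1).
  have e : n.*2 - (n - k) = n + k by lia.
  rewrite e in h1; rewrite -h1; last lia.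
  case: (posnP k) h2 => k0 h2 /=; first by case: won => //=; lia.
  have e' : n.*2 - (n - k.-1) = (n + k).-1 by lia.
  rewrite e' in h2; rewrite -h2; last lia.
  by case: won => //=; lia.
have -> : n + k = (n + k).-1.+1 by lia.
rewrite winsS /=; set m := (n + k).-1.
have [k0|k0] := posnP k.
  have := wins_sumb b r m; rewrite /m k0 => ?.
  by rewrite andbT; case: (_ == b); lia.
by case: (_ == b); lia.
Qed.

Lemma loser_score_eq n r k : k < n ->
  (loser_score n r == k) =
  ((wins true r (n + k).-1 == n.-1) && (r (n + k).-1 == true)) ||
  ((wins true r (n + k).-1 == k) && (r (n + k).-1 == false)).
Proof.
move=> kn; have n0 : 0 < n by exact: leq_trans kn.
have [b' [e1 e2 e3]] := duration_wins r n0.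
have [w1 w2 ls] := game_result e1 e2.
(* Player 2's victories are also expressed by the wins of Player 1, the only count whose law is
   computed. *)
have <- : wins false r (n + k).-1 == n.-1 = (wins true r (n + k).-1 == k).
  have := wins_sum r (n + k).-1; lia.
rewrite -(won_loser_score true r kn) -(won_loser_score false r kn).
by case: b' w1 w2 {e1 e2 e3 ls} => /= -> ->; rewrite /= ?orbF.
Qed.

End FirstToReach.

(** * Point masses of the binomial law *)

Section BinomialPoint.
Context {R : realType}.
Variable p : R.

Lemma bmean_pt m k :
  bmean p m (fun i => (i == k)%:R) = 'C(m, k)%:R * p ^+ k * (1 - p) ^+ (m - k).
Proof.
elim: m k => [|m IH] k /=.
  by case: k => [|k]; rewrite ?bin0n ?mul0r// !mulr1.
rewrite IH; case: k => [|k].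
  rewrite [X in p * X](_ : _ = 0); last exact: (bmean_cst p m 0).
  by rewrite !bin0 !subn0 !expr0 exprS mulr0 add0r !mul1r.
rewrite [X in p * X](_ : _ = bmean p m (fun i => (i == k)%:R))//.
rewrite IH binS subSS natrD exprS; have [km|mk] := ltnP k m.
  rewrite -(subnSK km) (exprS (1 - p)).
  by move: (_ ^+ (m - _)) => Q; move: (p ^+ k) => P; ring.
rewrite (@bin_small m k.+1)//.
by move: (_ ^+ (m - k)) => Q; move: (p ^+ k) => P; ring.
Qed.

End BinomialPoint.

(** * The laws of the number of wins and of the loser's score *)

Section IndependentRounds.
Context {R : realType} d (T : measurableType d) (P : probability T R) (p : R).
Context (X : nat -> {RV P >-> bool}).
Hypothesis hX : forall i : nat, P (X i @^-1` [set true]) = p%:E.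
Hypothesis hind : mutually_independent P X.

Let bern (b : bool) : R := if b then p else 1 - p.

Let P_round i b : P (X i @^-1` [set b]) = (bern b)%:E.
Proof.
case: b => /=; first exact: hX.
rewrite (_ : _ @^-1` _ = ~` (X i @^-1` [set true])).
  by rewrite probability_setC ?hX// -[_ @^-1` _]setTI; exact: measurable_funPT.
by apply/seteqP; split => w /=; case: (X i w).
Qed.

Lemma wins_eq b (r r' : nat -> bool) m :
  (forall i, (i < m)%N -> r i = r' i) -> wins b r m = wins b r' m.
Proof. by move=> rr'; apply: eq_bigr => i _; rewrite rr'. Qed.

Lemma measurable_local_event (N : nat) (g : (nat -> bool) -> bool) :
  (forall r r', (forall i, (i < N)%N -> r i = r' i) -> g r = g r') ->
  measurable [set w | g (X ^~ w)].
Proof.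
move=> gloc; have := measurable_fun_local X gloc.
by move=> /(_ measurableT [set true]); rewrite setTI; apply.
Qed.

Let P_cylinder (v : nat -> bool) l :
  P [set w | all (fun i => X i w == v i) (iota 0 l)] =
  (\prod_(i < l) bern (v i))%:E.
Proof.
have := @hind [fset i in iota 0 l]%fset (fun i => [set v i]) (fun _ => I).
rewrite (_ : \bigcap_(i in _) _ =
    [set w | all (fun i => X i w == v i) (iota 0 l)]).
  move=> ->; rewrite (eq_bigr (fun i => (bern (v i))%:E)) => [|i _]; last first.
    exact: P_round.
  rewrite prodEFin; congr EFin.
  rewrite (perm_big (index_iota 0 l)) ?big_mkord//.
  rewrite /index_iota subn0; apply: uniq_perm;
    rewrite ?fset_uniq ?iota_uniq// => i.
  by rewrite inE.
apply/seteqP; split => w /=.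
  move=> H; apply/allP => i il; apply/eqP; apply: H.
  by rewrite /= inE.
by move=> /allP H i /=; rewrite inE => /H /eqP.
Qed.

(** The induction on [m] moves round [m] from the counted rounds to those with a prescribed outcome,
    hence the generality in [A], [v] and [l]; for [m = 0] only independence is left. *)
Lemma P_wins_cylinder (A : pred nat) (v : nat -> bool) m l :
  P [set w | A (wins true (X ^~ w) m) &&
             all (fun i => X (m + i)%N w == v i) (iota 0 l)] =
  (bmean p m (fun k => (A k)%:R) * \prod_(i < l) bern (v i))%:E.
Proof.
elim: m l A v => [|m IH] l A v.
  rewrite /= /wins; under eq_set do rewrite big_ord0.
  case: (A 0%N) => /=; first by rewrite mul1r; exact: P_cylinder.
  by rewrite mul0r (_ : [set _ | _] = set0) ?measure0//; apply/seteqP; split.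
(* [vb b] prepends the outcome [b] of round [m] to the prescription, and [E b] splits the event by
   that outcome. *)
pose vb b i := if i is i'.+1 then v i' else b.
pose E (b : bool) := [set w | A (wins true (X ^~ w) m + b)%N &&
               all (fun i => X (m + i)%N w == vb b i) (iota 0 l.+1)].
have EE b w : E b w <-> A (wins true (X ^~ w) m.+1) &&
    all (fun i => X (m.+1 + i)%N w == v i) (iota 0 l) /\ X m w = b.
  rewrite /E /= addn0 winsS.
  have -> : all (fun i => X (m + i)%N w == vb b i) (iota 1 l) =
      all (fun i => X (m.+1 + i)%N w == v i) (iota 0 l).
    rewrite (iotaDl 1 0) all_map; apply: eq_all => i.
    by rewrite /= addnA addn1.
  split; first by move=> /and3P[h1 /eqP h2 h3]; rewrite h3 h2 eqb_id h1.
  by move=> [/andP[+ h2] h3]; rewrite h2 h3 eqxx eqb_id => ->.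
rewrite (_ : [set _ | _] = E true `|` E false); last first.
  apply/seteqP; split => w /=.
    by move=> h; case E1: (X m w); [left|right]; apply/EE.
  by case=> /EE[].
have mE b : measurable (E b).
  apply: (@measurable_local_event (m + l.+1) (fun r =>
               A (wins true r m + b)%N &&
               all (fun i => r (m + i)%N == vb b i) (iota 0 l.+1))) => r r' rr'.
  rewrite (@wins_eq _ r r'); last by move=> i im; rewrite rr'// ltn_addr.
  congr (_ && _); apply: eq_in_all => i; rewrite mem_iota => /andP[_ il].
  by rewrite rr'// ltn_add2l.
have -> : P (E true `|` E false) = (P (E true) + P (E false))%E.
  rewrite measureU//; apply/seteqP; split => w //= [/EE[_ h1] /EE[_ h2]].
  by rewrite h1 in h2.
have PE b : P (E b) =
    (bmean p m (fun k => (A (k + b)%N)%:R) *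
      (bern b * \prod_(i < l) bern (v i)))%:E.
  by rewrite (IH l.+1 (fun k => A (k + b)%N)) big_ord_recl.
rewrite !PE -EFinD /=; congr EFin.
have -> : bmean p m (fun k => (A (k + true)%N)%:R) =
    bmean p m ((fun k => (A k)%:R) \o S).
  by apply: eq_bmean => k; rewrite /= addn1.
have -> : bmean p m (fun k => (A (k + false)%N)%:R) =
    bmean p m (fun k => (A k)%:R).
  by apply: eq_bmean => k; rewrite /= addn0.
ring.
Qed.

Lemma P_wins (A : pred nat) m :
  P [set w | A (wins true (X ^~ w) m)] = (bmean p m (fun k => (A k)%:R))%:E.
Proof.
have := P_wins_cylinder A xpred0 m 0; rewrite /= big_ord0 mulr1 => <-.
by congr (P _); apply/seteqP; split => w /=; rewrite andbT.
Qed.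

Lemma P_wins_round m k (b : bool) :
  P [set w | (wins true (X ^~ w) m == k) && (X m w == b)] =
  ('C(m, k)%:R * p ^+ k * (1 - p) ^+ (m - k) * (if b then p else 1 - p))%:E.
Proof.
have := P_wins_cylinder (pred1 k) (fun=> b) m 1.
rewrite big_ord_recl big_ord0 mulr1 bmean_pt => <-.
by congr (P _); apply/seteqP; split => w /=; rewrite addn0 andbT.
Qed.

(** The event splits by the winner of round [n + k]; symmetry of the binomial coefficient gives both
    terms the same one. *)
Lemma P_loser_score n k : (k < n)%N ->
  P [set w | loser_score n (X ^~ w) == k] =
  ('C((n + k).-1, n.-1)%:R *
    (p ^+ n * (1 - p) ^+ k + p ^+ k * (1 - p) ^+ n))%:E.
Proof.
move=> kn; set m := (n + k).-1.
pose E b j := [set w | (wins true (X ^~ w) m == j) && (X m w == b)].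
have mE b j : measurable (E b j).
  apply: (@measurable_local_event m.+1
    (fun r => (wins true r m == j) && (r m == b))) => r r' rr'.
  by rewrite (@wins_eq _ r r') ?rr'// => i im; rewrite rr'// ltnW.
rewrite (_ : [set _ | _] = E true n.-1 `|` E false k); last first.
  apply/seteqP; split => w /=; rewrite (loser_score_eq _ kn).
    by case/orP; [left|right].
  by case=> h; apply/orP; [left|right].
have -> : P (E true n.-1 `|` E false k) = (P (E true n.-1) + P (E false k))%E.
  rewrite measureU//; apply/seteqP; split => w //=.
  by move=> [/andP[_ /eqP h1] /andP[_ /eqP h2]]; rewrite h1 in h2.
rewrite !P_wins_round -EFinD; congr EFin.
have -> : (m - n.-1 = k)%N by rewrite /m; lia.
have -> : (m - k = n.-1)%N by rewrite /m; lia.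
have -> : 'C(m, k) = 'C(m, n.-1).
  by rewrite -bin_sub ?/m; [congr 'C(_, _); lia | lia].
have -> : p ^+ n = p ^+ n.-1 * p by rewrite -exprSr prednK//; lia.
have -> : (1 - p) ^+ n = (1 - p) ^+ n.-1 * (1 - p).
  by rewrite -exprSr prednK//; lia.
by move: (_ ^+ n.-1) (_ ^+ n.-1) (_ ^+ k) (_ ^+ k) => P1 P2 P3 P4; ring.
Qed.

End IndependentRounds.

(** * The distribution function of the profit in terms of Player 1's wins *)

Section NetProfit.
Context {R : realType}.
Implicit Types (r : nat -> bool) (t u : R).

Lemma net_profitE n r : (0 < n)%N ->
  [/\ (loser_score n r < n)%N, won n true r = ~~ won n false r &
  net_profit R n r = if won n true r then n%:R - (loser_score n r)%:R
                     else (loser_score n r)%:R - n%:R].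
Proof.
move=> n0; have [b [e1 e2 e3]] := duration_wins r n0.
have [w1 w2 ls] := game_result e1 e2; rewrite ls /net_profit ls.
by split=> //; case: b w1 w2 {e1 e2 e3 ls} => /= -> -> //=;
  rewrite ?mulr0 ?mulr1 ?addr0 ?add0r.
Qed.

(** The profit is an integer and [j] is the least integer above [t], so the event is the negation of
    a profit of at least [j] for Player 1. *)
Lemma net_profit_le_ge0 n r t j : (0 < n)%N -> 0 <= t -> (j <= n)%N ->
  t < j%:R <= t + 1 ->
  (net_profit R n r <= t) = (wins true r (n.*2 - j) <= n.-1)%N.
Proof.
move=> n0 t0 jn /andP[tj jt].
have j0 : (0 < j)%N by rewrite -(ltr_nat R); lra.
have -> : (wins true r (n.*2 - j) <= n.-1)%N =
    ~~ (n <= wins true r (n.*2 - j))%N.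
  lia.
rewrite -won_wins_ge ?j0//.
have [ln _ ->] := net_profitE r n0; case: ifP => _ /=; last first.
  by apply: (le_trans _ t0); rewrite subr_le0 ler_nat ltnW.
rewrite -natrB ?(ltnW ln)//; apply/idP/idP => h.
  have : (n - loser_score n r < j)%N by rewrite -(ltr_nat R) (le_lt_trans h).
  lia.
have : (n - loser_score n r <= j.-1)%N by lia.
rewrite -(ler_nat R) => /le_trans; apply.
by move: jt; rewrite -{1}(prednK j0) -natr1; lra.
Qed.

(** Here [j] is [u] rounded up, and the event says that Player 2 gains at least [j]. *)
Lemma net_profit_le_lt0 n r u j : (0 < n)%N -> 0 < u -> (j <= n)%N ->
  u <= j%:R < u + 1 ->
  (net_profit R n r <= - u) = (wins true r (n.*2 - j) <= n - j)%N.
Proof.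
move=> n0 u0 jn /andP[uj ju].
have j0 : (0 < j)%N by rewrite -(ltr_nat R); lra.
have -> : (wins true r (n.*2 - j) <= n - j)%N =
    (n <= wins false r (n.*2 - j))%N.
  by have := wins_sum r (n.*2 - j); lia.
rewrite -won_wins_ge ?j0//.
have [ln w ->] := net_profitE r n0; rewrite w.
case: (won n false r) => /=; last first.
  apply/negbTE; rewrite -ltNge.
  by rewrite (@lt_le_trans _ _ 0) ?oppr_lt0// subr_ge0 ler_nat ltnW.
rewrite -opprB lerN2 -natrB ?(ltnW ln)//; apply/idP/idP => h.
  have : (j < (n - loser_score n r).+1)%N.
    by rewrite -(ltr_nat R) -natr1 (lt_le_trans ju)// lerD2r.
  lia.
apply: (le_trans uj); rewrite ler_nat; lia.
Qed.

Lemma natr_ge_lt1 u : 0 <= u -> exists j : nat, u <= j%:R < u + 1.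
Proof.
move=> u0; have /andP[h1 h2] := truncn_itv u0.
have [e|ne] := eqVneq (Num.truncn u)%:R u.
  by exists (Num.truncn u); rewrite e lexx ltrDl ltr01.
exists (Num.truncn u).+1; rewrite (ltW h2) -natr1 ltrD2r.
by rewrite lt_neqAle ne.
Qed.

End NetProfit.

(** * The bound on the error term in the law of the loser's score *)

Section MainTheorem.
Context {R : realType}.

Lemma leq_bin2 m k : ('C(m, k) <= 2 ^ m)%N.
Proof.
elim: m k => [|m IH] [|k]; rewrite ?bin0n ?bin0 ?expn_gt0//.
by rewrite binS expnS mul2n -addnn leq_add.
Qed.

(** The coefficient is at most [2 ^ (n + k)], and [2 * p >= 1] gives [p ^ k <= p ^ n * 2 ^ (n - k)];
    the powers of 2 multiply to [4 ^ n]. *)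
Lemma loser_score_error_le (p : R) n k : 1 / 2 <= p < 1 -> (k < n)%N ->
  `|'C((n + k).-1, n.-1)%:R * p ^+ k * (1 - p) ^+ n| <= (4 * p * (1 - p)) ^+ n.
Proof.
move=> /andP[p12 p1] kn; have p0 : 0 < p by lra.
have q0 : 0 < 1 - p by lra.
have C2 : ('C((n + k).-1, n.-1) <= 2 ^ (n + k))%N.
  by apply: leq_trans (leq_bin2 _ _) _; rewrite leq_exp2l// leq_pred.
have pk : p ^+ k <= p ^+ n * 2 ^+ (n - k).
  rewrite -{1}(subnKC (ltnW kn)) exprD -mulrA -exprMn.
  rewrite ler_peMr ?exprn_ge0 ?(ltW p0)//.
  by rewrite exprn_ege1//; lra.
rewrite ger0_norm ?mulr_ge0 ?exprn_ge0 ?(ltW p0) ?(ltW q0)//.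
have -> : (4 * p * (1 - p)) ^+ n =
    2 ^+ (n + k) * (p ^+ n * 2 ^+ (n - k)) * (1 - p) ^+ n.
  have E : 4 ^+ n = 2 ^+ (n + k) * 2 ^+ (n - k) :> R.
    rewrite -exprD (_ : n + k + (n - k) = 2 * n)%N; last by lia.
    by rewrite exprM expr2 -natrM.
  rewrite !exprMn E; move: (2 ^+ _) (2 ^+ _) (p ^+ n) (_ ^+ n) => a b c e; ring.
rewrite ler_wpM2r ?exprn_ge0 ?(ltW q0)// ler_pM ?exprn_ge0 ?(ltW p0)//.
by rewrite -natrX ler_nat.
Qed.

End MainTheorem.

(** * Standardized thresholds and their limit *)

Section Standardization.
Context {R : realType}.
Variables (p x : R).
Hypothesis p01 : 0 < p < 1.

Local Notation q := (1 - p).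
Local Notation s n := (Num.sqrt (n%:R * q) : R).

Let p0 : 0 < p. Proof. by case/andP: p01. Qed.
Let q0 : 0 < q. Proof. by rewrite subr_gt0; case/andP: p01. Qed.

Lemma sqrt_natM_ge (A : R) : \forall n \near \oo, A <= s n.
Proof.
near=> n; have [A0|A0] := ltP A 0.
  by rewrite (le_trans (ltW A0)) ?sqrtr_ge0.
rewrite -(@ler_pXn2r _ 2)// ?nnegrE ?sqrtr_ge0//.
rewrite sqr_sqrtr ?mulr_ge0 ?(ltW q0)// -ler_pdivrMr//.
by near: n; exact: nbhs_infty_ger.
Unshelve. all: by end_near. Qed.

(** Up to rounding, absorbed by the constants 2, [k] exceeds the mean [m * p] by [x * s n]; and
    [m * p] is so close to [n] that [n * q] may replace the variance [m * p * q]. *)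
Definition near_mean (n m k : nat) : Prop :=
  `|k%:R - m%:R * p - x * s n| <= 2 /\ `|m%:R * p - n%:R| <= `|x| * s n + 2.

Let div_le (B e a b : R) :
  0 < e -> 0 < b -> `|a| <= B -> B / e <= b -> `|a / b| <= e.
Proof.
move=> e0 b0 aB Bb; rewrite normrM normfV (gtr0_norm b0) ler_pdivrMr//.
by apply: le_trans aB _; rewrite mulrC -ler_pdivrMr.
Qed.

(** [bstd] factors as [(k - m * p) / s n], which tends to [x], times the inverse square root of
    [m * p / n], which tends to 1. *)
Lemma cvg_bstd (m k : nat -> nat) :
  (\forall n \near \oo, near_mean n (m n) (k n)) ->
  bstd p (m n) (k n) @[n --> \oo] --> x.
Proof.
move=> H.
have e_cvg : ((k n)%:R - (m n)%:R * p - x * s n) / s n @[n --> \oo] --> (0 : R).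
  apply/cvgrPdist_le => e e0; near=> n; rewrite sub0r normrN.
  apply: (@div_le 2 e) => //; last by near: n; exact: sqrt_natM_ge.
    by apply: (@lt_le_trans _ _ 1) => //; near: n; exact: sqrt_natM_ge.
  by near: n; apply: filterS H => n [].
have h_cvg : (m n)%:R * p / n%:R @[n --> \oo] --> (1 : R).
  apply/cvgrPdist_le => e e0; near=> n.
  have s1 : 1 <= s n by near: n; exact: sqrt_natM_ge.
  have n0 : (0 : R) < n%:R.
    rewrite ltr0n lt0n; apply: contraTneq s1 => ->.
    by rewrite mul0r sqrtr0 -ltNge ltr01.
  have ss : s n ^+ 2 = n%:R * q by rewrite sqr_sqrtr// ltW// mulr_gt0.
  have -> : 1 - (m n)%:R * p / n%:R = - ((m n)%:R * p - n%:R) / n%:R.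
    by field; rewrite gt_eqF.
  rewrite mulNr normrN.
  apply: (@div_le (`|x| * s n + 2) e) => //.
    by near: n; apply: filterS H => n [].
  (* Then [|x| * s n + 2 <= (|x| + 2) * s n <= e * s n ^+ 2 <= e * n]. *)
  have B : (`|x| + 2) / e <= s n by near: n; exact: sqrt_natM_ge.
  rewrite ler_pdivrMr//; rewrite ler_pdivrMr// in B.
  have := normr_ge0 x; have : s n ^+ 2 <= n%:R.
    by rewrite ss ler_piMr// lerBlDr lerDl ltW.
  nra.
have g_cvg : (Num.sqrt ((m n)%:R * p / n%:R))^-1 @[n --> \oo] --> (1 : R).
  have h := cvg_comp _ _ h_cvg (@sqrt_continuous R 1).
  have := cvgV _ h; rewrite sqrtr1 invr1; apply.
  exact: oner_neq0.
have L : (x + ((k n)%:R - (m n)%:R * p - x * s n) / s n) *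
    (Num.sqrt ((m n)%:R * p / n%:R))^-1 @[n --> \oo] --> (x + 0) * 1.
  exact: cvgM (cvgD (cvg_cst x) e_cvg) g_cvg.
rewrite addr0 mulr1 in L; apply: cvg_trans L; apply: near_eq_cvg; near=> n.
have s1 : 1 <= s n by near: n; exact: sqrt_natM_ge.
have s0 : 0 < s n by apply: lt_le_trans s1.
have n0 : (0 : R) < n%:R.
  rewrite ltr0n lt0n; apply: contraTneq s1 => ->.
  by rewrite mul0r sqrtr0 -ltNge ltr01.
have -> : bstd p (m n) (k n) = ((k n)%:R - (m n)%:R * p) / s n *
    (s n / Num.sqrt ((m n)%:R * p * q)).
  by rewrite /bstd mulrA mulfVK ?gt_eqF.
congr (_ * _).
  by field; rewrite gt_eqF.
have -> : (m n)%:R * p * q = (m n)%:R * p / n%:R * (n%:R * q).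
  by field; rewrite gt_eqF.
rewrite (sqrtrM (n%:R * q)) ?divr_ge0 ?mulr_ge0 ?(ltW p0) ?(ltW n0)//.
by rewrite invfM mulrCA divff ?mulr1// gt_eqF.
Unshelve. all: by end_near. Qed.

End Standardization.

(** * The standardized profit as a binomial event *)

Section GameAsymptotics.
Context {R : realType}.
Variables (p x : R).
Hypothesis hp : 1 / 2 <= p < 1.

Local Notation q := (1 - p).
Local Notation s n := (Num.sqrt (n%:R * q) : R).

Lemma net_profit_binomial_event :
  \forall n \near \oo, exists mk : nat * nat,
    [/\ near_mean p x n mk.1 mk.2, (n <= mk.1)%N &
    forall r, (p * net_profit R n r - (p - q) * n%:R) / s n <= x =
      (wins true r mk.1 <= mk.2)%N].
Proof.
have [p12 p1] : 1 / 2 <= p /\ p < 1 by case/andP: hp.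
have p0 : 0 < p by lra.
have q0 : 0 < q by rewrite subr_gt0.
have p01 : 0 < p < 1 by rewrite p0.
(* The event bounds the profit by [((p - q) * n + x * s n) / p]. For large [n] this level is
   nonnegative in the first case and negative in the second, and the two signs call for different
   counts of wins. *)
have [sgn|sgn] : (0 < p - q \/ 0 <= x) \/ (p = q /\ x < 0).
  have [x0|x0] := leP 0 x; first by left; right.
  have [pq|pq] := ltP q p; first by left; left; rewrite subr_gt0.
  by right; split=> //; lra.
- near=> n.
  have s1 : `|x| + 1 <= s n by near: n; exact: sqrt_natM_ge.
  have x0 := normr_ge0 x; have xx := ler_norm x.
  have s0 : 0 < s n by lra.
  have n0 : (0 < n)%N.
    rewrite lt0n; apply: contraTneq s0 => ->.
    by rewrite mul0r sqrtr0 ltxx.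
  have ss : s n ^+ 2 = n%:R * q by rewrite sqr_sqrtr// mulr_ge0// ltW.
  set t := ((p - q) * n%:R + x * s n) / p.
  have pt : p * t = (p - q) * n%:R + x * s n by rewrite /t mulrC divfK// gt_eqF.
  have t0 : 0 <= t.
    rewrite /t divr_ge0 ?(ltW p0)//; case: sgn => [mu0|x00]; last first.
      by rewrite addr_ge0// mulr_ge0 ?ler0n ?(ltW s0)//; lra.
    (* As [s n ^+ 2 = n * q], the numerator of [t] times [q] is [s n * ((p - q) * s n + x * q)],
       nonnegative once [s n] passes this bound. *)
    have B : - (x * q / (p - q)) <= s n by near: n; exact: sqrt_natM_ge.
    have : 0 <= s n * ((p - q) * s n + x * q).
      rewrite mulr_ge0 ?(ltW s0)// -(@ler_pM2r _ (p - q)^-1) ?invr_gt0// mul0r.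
      by rewrite mulrDl (mulrC (p - q)) mulfK ?gt_eqF//; lra.
    have -> : s n * ((p - q) * s n + x * q) = ((p - q) * n%:R + x * s n) * q.
      transitivity ((p - q) * s n ^+ 2 + x * q * s n); first by ring.
      by rewrite ss; ring.
    by rewrite pmulr_lge0.
  (* This ensures [j <= n]. Multiplied by [p], it reads [x * s n + p <= n * q = s n ^+ 2], which
     follows from [s n >= |x| + 1]. *)
  have tn : t + 1 <= n%:R.
    rewrite -(@ler_pM2l _ p)// mulrDr pt mulr1.
    have : x * s n + p <= s n ^+ 2 by nra.
    rewrite ss; lra.
  have [j jt] : exists j : nat, t < j%:R <= t + 1.
    have /andP[j1 j2] := truncn_itv t0.
    by exists (Num.truncn t).+1; rewrite j2 -natr1 lerD2r.
  have jn : (j <= n)%N.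
    by rewrite -(ler_nat R); apply: le_trans tn; case/andP: jt.
  have jn2 : (j <= n.*2)%N by rewrite -addnn (leq_trans jn)// leq_addr.
  exists (n.*2 - j, n.-1)%N => /=; split.
  + have e1 : (n.*2 - j)%:R = 2 * n%:R - j%:R :> R.
      by rewrite natrB// -mul2n natrM.
    have e2 : n.-1%:R = n%:R - 1 :> R by rewrite -{2}(prednK n0) -natr1 addrK.
    rewrite /near_mean e1 e2; case/andP: jt => t1 t2.
    have h1 : p * t < p * j%:R by rewrite ltr_pM2l.
    have h2 : p * j%:R <= p * t + p.
      by rewrite -[X in _ + X]mulr1 -mulrDr ler_pM2l.
    have xs : `|x * s n| = `|x| * s n by rewrite normrM (gtr0_norm s0).
    have := ler_norm (x * s n); have := ler_norm (- (x * s n)).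
    rewrite normrN xs => h3 h4.
    by split; rewrite ler_norml; apply/andP; split; lra.
  + by rewrite -addnn -addnBA// leq_addr.
  + move=> r; rewrite -(net_profit_le_ge0 r n0 t0 jn jt).
    rewrite ler_pdivrMr// lerBlDr addrC -pt.
    by rewrite ler_pM2l.
- near=> n.
  have s1 : `|x| + 1 <= s n by near: n; exact: sqrt_natM_ge.
  case: sgn => pq x0; have xx := ltr0_norm x0.
  have s0 : 0 < s n by lra.
  have n0 : (0 < n)%N.
    rewrite lt0n; apply: contraTneq s0 => ->.
    by rewrite mul0r sqrtr0 ltxx.
  have ss : s n ^+ 2 = n%:R * q by rewrite sqr_sqrtr// mulr_ge0// ltW.
  set u := - (x * s n) / p.
  have pu : p * u = - (x * s n) by rewrite /u mulrC divfK// gt_eqF.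
  have xs0 : x * s n < 0 by rewrite nmulr_rlt0.
  have u0 : 0 < u by rewrite /u divr_gt0// oppr_gt0.
  have un : u + 1 <= n%:R.
    rewrite -(@ler_pM2l _ p)// mulrDr pu mulr1.
    have : - (x * s n) + p <= s n ^+ 2 by nra.
    rewrite ss -pq; lra.
  have [j ju] := natr_ge_lt1 (ltW u0).
  have jn : (j <= n)%N.
    by rewrite -(ler_nat R); apply: le_trans un; case/andP: ju => _ /ltW.
  have jn2 : (j <= n.*2)%N by rewrite -addnn (leq_trans jn)// leq_addr.
  exists (n.*2 - j, n - j)%N => /=; split.
  + have e1 : (n.*2 - j)%:R = 2 * n%:R - j%:R :> R.
      by rewrite natrB// -mul2n natrM.
    rewrite /near_mean e1 natrB//; case/andP: ju => t1 t2.
    have h1 : p * u <= p * j%:R by rewrite ler_pM2l.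
    have h2 : p * j%:R < p * u + p.
      by rewrite -[X in _ + X]mulr1 -mulrDr ltr_pM2l.
    have ph : p = 1 / 2 by lra.
    by rewrite xx; split; rewrite ler_norml; apply/andP; split;
      move: h1 h2 pu t1 t2; rewrite ph; lra.
  + by rewrite -addnn -addnBA// leq_addr.
  + move=> r; rewrite -(net_profit_le_lt0 r n0 u0 jn ju).
    have mu0 : p - q = 0 by lra.
    rewrite ler_pdivrMr// mu0 mul0r subr0 -[x * _]opprK -pu -mulrN.
    by rewrite ler_pM2l.
Unshelve. all: by end_near. Qed.

End GameAsymptotics.

(** * The law of the loser's score and the limit law of the profit *)

Unset Implicit Arguments.
Set Strict Implicit.

Theorem theorem2p4 (R : realType) (d : measure_display) (T : measurableType d)
    (P : probability T R) (p : R) (X : nat -> {RV P >-> bool})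
    (hp : 1 / 2 <= p < 1)
    (hX : forall i : nat, P (X i @^-1` [set true]) = p%:E)
    (hind : mutually_independent P X) :
  let q : R := 1 - p in
  let mu : R := p - q in
  let W (n : nat) : {RV P >-> nat} := loser_score_rv X n in
  let Z (n : nat) : {RV P >-> R} := net_profit_rv R X n in
  (exists alpha : nat -> nat -> R,
     forall n k : nat, (1 <= n)%N -> (k < n)%N ->
       P (W n @^-1` [set k]) =
         ('C(n + k - 1, n - 1)%:R * q ^+ k * p ^+ n + alpha n k)%:E
       /\ `|alpha n k| <= (4 * p * q) ^+ n)
  /\ cvg_in_distribution P
       (fun n : nat => affine_rv p (mu * n%:R) (Num.sqrt (n%:R * q)) (Z n))
       (normal_prob 0 1).
Proof.
move=> q mu W Z; split.
  (* The error term is the contribution of Player 2's victories. *)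
  exists (fun n k => 'C((n + k).-1, n.-1)%:R * p ^+ k * q ^+ n) => n k n1 kn.
  split; last exact: loser_score_error_le.
  rewrite (_ : W n @^-1` [set k] = [set w | loser_score n (X ^~ w) == k]).
    rewrite (P_loser_score hX hind kn) !subn1; congr EFin.
    by rewrite mulrDr mulrA mulrA -!mulrA (mulrC (p ^+ n)).
  by apply/seteqP; split => w /eqP.
move=> x _.
pose good n (mk : nat * nat) := [/\ near_mean p x n mk.1 mk.2, (n <= mk.1)%N &
    forall r,
      (p * net_profit R n r - (p - q) * n%:R) / Num.sqrt (n%:R * q) <= x =
      (wins true r mk.1 <= mk.2)%N].
(* The pairs are chosen as one sequence; the default [(0, 0)] is taken only where no good pair
   exists, hence for finitely many [n]. *)
pose f n := xget (0, 0)%N [set mk | good n mk].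
have gf : \forall n \near \oo, good n (f n).
  apply: filterS (net_profit_binomial_event x hp) => n [mk gmk].
  exact: (@xgetPex _ (0, 0)%N [set mk | good n mk] (ex_intro _ mk gmk)).
have p01 : 0 < p < 1.
  by case/andP: hp => h1 ->; rewrite andbT (lt_le_trans _ h1)// divr_gt0.
have foo : (f n).1 @[n --> \oo] --> \oo.
  move=> A [N _ NA]; suff : \forall n \near \oo, A (f n).1 by [].
  near=> n; apply: NA => /=.
  apply: (@leq_trans n); first by near: n; exists N.
  by near: n; apply: filterS gf => n [].
have clt := de_moivre_laplace p01 foo
  (cvg_bstd p01 (filterS (fun n (g : good n (f n)) =>
    let: And3 a _ _ := g in a) gf)).
rewrite [X in _ --> X](_ : _ = (gauss_cdf x)%:E); last first.
  by rewrite /gauss_cdf fineK// fin_num_measure.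
have L : (bmean p (f n).1 (fun i => (i <= (f n).2)%N%:R))%:E @[n --> \oo] -->
    (gauss_cdf x)%:E.
  by apply: cvg_EFin; [exact: nearW | exact: clt].
(* For every good [n] the distribution function at [x] equals the binomial mean. *)
apply: cvg_trans L; apply: near_eq_cvg; near=> n.
have [_ _ e] : good n (f n) by near: n.
rewrite -(P_wins hX hind (fun i => (i <= (f n).2)%N)).
rewrite /cdf /distribution /pushforward.
congr (P _); apply/seteqP; split => w /=;
  by rewrite in_itv/= /affine_rv /net_profit_rv e.
Unshelve. all: by end_near. Qed.
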